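(* Let $n\ge 1$ and consider the potential $V(x)=V_0(x)+V_1(x)$ on $\mathbb{R}^n$, where $V_0$ is smooth and trapping ($V_0(x)\to\infty$ as $|x|\to\infty$) and $V_1$ depends on $\epsilon>0$. Assume that: 1. there exist $p\ge 1$ and constants $V_{\min}\in\mathbb{R}$ and $C_p>0$ such that $V_0(x)\ge V_{\min}+C_p\sum_{i=1}^n|x_i|^p$ for all $x\in\mathbb{R}^n$; 2. there are $\delta>0$ and constants $D_0,D_1$ such that $|\nabla V_0(x)|\le D_0+D_1|x|^{\delta}$ for all $x$; 3. $V_1(x)=\sum_{i=1}^n A_i\cos\!\left(\frac{x_i}{\ell_i\epsilon}\right)$ with $0<\underline{A}\le|A_i|\le\overline{A}<\infty$ and $0<\underline{\ell}\le\ell_i\le\overline{\ell}<\infty$ for all $i$; 4. $\alpha\ge 0$, $\theta\in\mathbb{R}$, $\gamma>0$ satisfy $2\alpha+\delta\gamma+\theta<1$. Let $\sigma=\epsilon^{\alpha}$ and let $\mathcal{T}_{\rm MALA}$ be the transition operator of MALA with step parameter $\sigma$ sampling $\mu(dx)\propto e^{-V(x)}dx$. Then there exists a constant $\kappa>0$, independent of $\epsilon$, such that $$\mathrm{Gap}(\mathcal{T}_{\rm MALA})\lesssim e^{-\frac12\kappa\epsilon^{-\gamma p}}+e^{-\frac1{32}\epsilon^{-2(1-\alpha-\theta)}}+\epsilon^{n(2\theta-\alpha)},$$ where $\lesssim$ means that the left side is bounded by a constant independent of $\epsilon$ times the right side, for all sufficiently small $\epsilon>0$.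
   Context: MALA (at inverse temperature $\beta=1$) with parameter $\sigma>0$: given $X_k$, propose $X^{\mathrm p}_{k+1}=X_k-\frac{\sigma^2}{2}\nabla V(X_k)+\sigma\xi_{k+1}$, $\xi_{k+1}\sim N(0,I)$ independent. Let $q(x\to y)$ be the proposal density, i.e. the density of $N(x-\frac{\sigma^2}{2}\nabla V(x),\sigma^2 I)$, and $R(x,y)=V(x)-V(y)+\log\frac{q(y\to x)}{q(x\to y)}$. With probability $F(R(X_k,X^{\mathrm p}_{k+1}))$ set $X_{k+1}=X^{\mathrm p}_{k+1}$, else $X_{k+1}=X_k$, where $F(r)=\min(1,e^r)$ (Metropolis) or $F(r)=(1+e^{-r})^{-1}$ (Barker). The chain is reversible with respect to $\mu$. Spectral gap: $\mathrm{Gap}(\mathcal{T})=1-\sup_{\lambda\in\sigma(\mathcal{T})\setminus\{1\}}\lambda$, used in its Dirichlet-form expression $$\mathrm{Gap}(\mathcal{T})=\inf_{f\in L^2(\mu),\ \mathrm{Var}_\mu(f)>0}\frac{\mathbb{E}_\mu[|f(X_{k+1})-f(X_k)|^2]}{2\,\mathrm{Var}_\mu(f(X))},$$ with $\mathbb{E}_\mu$ taken over one step of the chain started from $X_k\sim\mu$. The function $V_0$ and the constants $n,p,V_{\min},C_p,D_0,D_1,\delta,A_i,\ell_i,\alpha,\theta,\gamma$ do not depend on $\epsilon$. *)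

(* Defs.v *)
From HB Require Import structures.
From mathcomp Require Import all_boot all_order all_algebra.
From mathcomp Require Import all_classical all_reals all_analysis.
From mathcomp Require Import measurable_realfun.

Set Implicit Arguments.
Unset Strict Implicit.
Unset Printing Implicit Defensive.

Import Order.TTheory GRing.Theory Num.Theory.
Import numFieldNormedType.Exports.

Local Open Scope classical_set_scope.
Local Open Scope ring_scope.

(* The library gives ['rV[R]_n] its topology but neither a sigma-algebra
   nor a Lebesgue measure. The sigma-algebra below is the one generated by the
   coordinates; for [T := R] it is the Borel sigma-algebra of R^n. *)
Definition measure_rV_display : measure_display -> measure_display.
Proof. exact. Qed.

Section measurable_rV.
Context {d} {T : measurableType d}.
Variable n : nat.

Let coords : 'I_n -> 'rV[T]_n -> T := fun i x => x ord0 i.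

Let rV_set0 : g_sigma_preimage coords set0.
Proof. exact: sigma_algebra0. Qed.

Let rV_setC A : g_sigma_preimage coords A -> g_sigma_preimage coords (~` A).
Proof. exact: sigma_algebraC. Qed.

Let rV_bigcup (F : _^nat) : (forall i, g_sigma_preimage coords (F i)) ->
  g_sigma_preimage coords (\bigcup_i (F i)).
Proof. exact: sigma_algebra_bigcup. Qed.

HB.instance Definition _ := @isMeasurable.Build (measure_rV_display d)
  'rV[T]_n (g_sigma_preimage coords) rV_set0 rV_setC rV_bigcup.

End measurable_rV.

Lemma measurable_coord d (T : measurableType d) n (i : 'I_n) :
  measurable_fun [set: 'rV[T]_n] (fun x : 'rV[T]_n => x ord0 i).
Proof.
move=> _ Y mY; rewrite setTI; apply: sub_sigma_algebra => /=.
rewrite -bigcup_seq/=; exists i => /=; first by rewrite mem_index_enum.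
by exists Y => //; rewrite setTI.
Qed.

Lemma measurable_fun_coordP d1 d2 (T1 : measurableType d1)
    (T2 : measurableType d2) n (f : T1 -> 'rV[T2]_n) :
  measurable_fun [set: T1] f <->
  forall i, measurable_fun [set: T1] (fun x => f x ord0 i).
Proof.
split=> [mf i|mf].
  exact: (measurableT_comp (measurable_coord i) mf).
move=> _ A mA; rewrite setTI; move: A mA.
apply: smallest_sub.
  split => /=.
  - by rewrite preimage_set0.
  - by move=> A mA; rewrite setTD -preimage_setC; exact: measurableC.
  - by move=> F mF; rewrite preimage_bigcup; exact: bigcupT_measurable.
rewrite -bigcup_seq => A [i _ [B mB <-]].
by have := mf i measurableT B mB; rewrite !setTI.
Qed.

Section lebesgue_rV.
Context {R : realType}.

Definition cons_rV n (z : R * 'rV[R]_n) : 'rV[R]_n.+1 :=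
  \row_i if unlift ord0 i is Some j then z.2 ord0 j else z.1.

Definition uncons_rV n (x : 'rV[R]_n.+1) : R * 'rV[R]_n :=
  (x ord0 ord0, \row_j x ord0 (lift ord0 j)).

Lemma cons_rVK n : cancel (@cons_rV n) (@uncons_rV n).
Proof.
move=> [a x]; rewrite /uncons_rV /cons_rV mxE unlift_none; congr pair.
by apply/rowP => j; rewrite !mxE liftK.
Qed.

Lemma measurable_cons_rV n : measurable_fun setT (@cons_rV n).
Proof.
apply/measurable_fun_coordP => i; under eq_fun do rewrite mxE.
case: unliftP => [j _|_]; last exact: measurable_fst.
exact: (measurableT_comp (measurable_coord j) measurable_snd).
Qed.

Lemma measurable_uncons_rV n : measurable_fun setT (@uncons_rV n).
Proof.
apply: measurable_fun_pair; first exact: measurable_coord.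
apply/measurable_fun_coordP => i; under eq_fun do rewrite mxE.
exact: measurable_coord.
Qed.

Section cons_measure.
Local Open Scope ereal_scope.
Variables (n : nat) (m : {sigma_finite_measure set 'rV[R]_n -> \bar R}).

Definition cons_measure : set 'rV[R]_n.+1 -> \bar R :=
  pushforward (lebesgue_measure \x m) (@cons_rV n).

Let mpre A : measurable A -> measurable (@cons_rV n @^-1` A).
Proof.
by move=> mA; rewrite -[X in measurable X]setTI; exact: measurable_cons_rV.
Qed.

Let cons_measure0 : cons_measure set0 = 0.
Proof. by rewrite /cons_measure /pushforward preimage_set0 measure0. Qed.

Let cons_measure_ge0 A : 0 <= cons_measure A.
Proof. by rewrite /cons_measure /pushforward measure_ge0. Qed.

Let cons_measure_sigma_additive : semi_sigma_additive cons_measure.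
Proof.
move=> F mF tF mUF; rewrite /cons_measure /pushforward preimage_bigcup.
apply: measure_semi_sigma_additive => [k||]; first exact: mpre.
- apply/trivIsetP => i j _ _ ij; rewrite -preimage_setI.
  by move/trivIsetP : tF => /(_ _ _ _ _ ij) ->//; rewrite preimage_set0.
- by rewrite -preimage_bigcup; exact: mpre.
Qed.

HB.instance Definition _ := isMeasure.Build _ _ _ cons_measure
  cons_measure0 cons_measure_ge0 cons_measure_sigma_additive.

Let cons_measure_sigma_finite : sigma_finite setT cons_measure.
Proof.
have /sigma_finiteP[F [TF ndF Foo]] :=
  sigma_finiteT (@lebesgue_measure R : {sigma_finite_measure set _ -> \bar R}).
have /sigma_finiteP[G [TG ndG Goo]] := sigma_finiteT m.
exists (fun k => @uncons_rV n @^-1` (F k `*` G k)) => [|k].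
  rewrite -preimage_bigcup -(preimage_setT (@uncons_rV n)); congr (_ @^-1` _).
  rewrite -setXTT TF TG predeqE => -[x y]; split.
    move=> [/= [k _ Fkx] [l _ Gly]]; exists (maxn k l) => //; split.
    - by move: x Fkx; exact/subsetPset/ndF/leq_maxl.
    - by move: y Gly; exact/subsetPset/ndG/leq_maxr.
  by move=> [k _ []/= ? ?]; split; exists k.
have [mFk Fkoo] := Foo k; have [mGk Gkoo] := Goo k; split.
  rewrite -[X in measurable X]setTI; apply: measurable_uncons_rV => //.
  exact: measurableX.
rewrite /cons_measure /pushforward -comp_preimage.
rewrite (_ : _ \o _ = id); last by apply/funext => z /=; rewrite cons_rVK.
by rewrite preimage_id product_measure1E// lte_mul_pinfty// ge0_fin_numE.
Qed.

HB.instance Definition _ := Measure_isSigmaFinite.Build _ _ _ cons_measure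
  cons_measure_sigma_finite.

End cons_measure.

Fixpoint lebesgue_rV n : {sigma_finite_measure set 'rV[R]_n -> \bar R} :=
  if n is n'.+1 then cons_measure (lebesgue_rV n') else \d_(0 : 'rV[R]_0).

Lemma measurable_box n (A : 'I_n -> set R) :
  (forall i, measurable (A i)) ->
  measurable [set x : 'rV[R]_n | forall i, A i (x ord0 i)].
Proof.
move=> mA; rewrite (_ : mkset _ = \bigcap_(i in [set: 'I_n])
    ((fun x : 'rV[R]_n => x ord0 i) @^-1` A i)).
  apply: fin_bigcap_measurable => // i _.
  by rewrite -[X in measurable X]setTI; exact: measurable_coord.
by apply/seteqP; split => x /=; [move=> h i _; exact: h|move=> h i; exact: h].
Qed.

Lemma lebesgue_rV_box n (A : 'I_n -> set R) :
  (forall i, measurable (A i)) ->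
  lebesgue_rV n [set x | forall i, A i (x ord0 i)] =
  (\prod_(i < n) lebesgue_measure (A i))%E.
Proof.
elim: n A => [|n ih] A mA.
  by rewrite big_ord0 /= diracE mem_set//= => -[].
rewrite big_ord_recl -ih// /= /cons_measure /pushforward.
rewrite -product_measure1E//; [|exact: mA|]; last first.
  exact: (@measurable_box n (fun i => A (lift ord0 i)) (fun i => mA _)).
congr (product_measure1 _ _ _); apply/seteqP; split => -[a x] /=.
  move=> h; split => [|i]; first by have := h ord0; rewrite mxE unlift_none.
  by have := h (lift ord0 i); rewrite mxE liftK.
by move=> [h0 h] i; rewrite mxE; case: unliftP => [j ->|->].
Qed.

End lebesgue_rV.

(* The measure w dm when [w] is nonnegative and measurable, and by convention
   the zero measure otherwise. *)
Section density_measure.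
Local Open Scope ereal_scope.
Context d (T : measurableType d) (R : realType).
Variables (m : {measure set T -> \bar R}) (w : T -> R).

Definition density_measure (A : set T) : \bar R :=
  if `[< measurable_fun setT w /\ forall x, (0 <= w x)%R >]
  then \int[m]_(x in A) (w x)%:E else 0.

Let density_measure0 : density_measure set0 = 0.
Proof. by rewrite /density_measure integral_set0 if_same. Qed.

Let density_measure_ge0 A : 0 <= density_measure A.
Proof.
rewrite /density_measure; case: asboolP => [[_ w0]|//].
by apply: integral_ge0 => x _; rewrite lee_fin.
Qed.

Let density_measure_sigma_additive : semi_sigma_additive density_measure.
Proof.
rewrite /density_measure; case: asboolP => [[mw w0]|_].
  apply: semi_sigma_additive_nng_induced => [|x]; last by rewrite lee_fin.
  exact/measurable_EFinP.
by move=> F _ _ _; under eq_fun do rewrite big1//; exact: cvg_cst.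
Qed.

HB.instance Definition _ := isMeasure.Build _ _ _ density_measure
  density_measure0 density_measure_ge0 density_measure_sigma_additive.

End density_measure.

Section calculus.
Context {R : realType} {n : nat}.
Implicit Types (f V : 'rV[R]_n -> R) (x : 'rV[R]_n).

(* Euclidean norm; the library norm [`|x|] on ['rV] is the sup norm. *)
Definition enorm x : R := Num.sqrt (\sum_(i < n) x ord0 i ^+ 2).

Definition partial (i : 'I_n) f x : R := 'D_(delta_mx ord0 i) f x.

Definition grad f x : 'rV[R]_n := \row_i partial i f x.

Fixpoint Ck (k : nat) f : Prop :=
  continuous f /\
  if k is k'.+1 then
    forall i : 'I_n,
      (forall x, derivable f x (delta_mx ord0 i)) /\ Ck k' (partial i f)
  else True.

Definition smooth f : Prop := forall k, Ck k f.

Definition trapping f : Prop :=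
  forall M : R, exists r : R, forall x, r <= enorm x -> M <= f x.

End calculus.

Section mala.
Context {R : realType} {n : nat}.
Implicit Types (F : R -> R) (V : 'rV[R]_n -> R) (s : R) (x y : 'rV[R]_n).

(* [V] continuous and e^{-V} integrable is the intended domain; the Dirac mass
   is only the default value required by [mnormalize]. *)
Definition gibbs V : probability 'rV[R]_n R :=
  mnormalize (density_measure (lebesgue_rV n) (fun x => expR (- V x)))
             \d_(0 : 'rV[R]_n).

Definition metropolis (r : R) : R := Num.min 1 (expR r).

Definition barker (r : R) : R := (1 + expR (- r))^-1.

Definition mala_mean V s x : 'rV[R]_n := x - (s ^+ 2 / 2) *: grad V x.

(* N(m, s^2 I) is the product of the N(m_i, s^2). *)
Definition mala_density V s x y : R :=
  \prod_(i < n) normal_pdf (mala_mean V s x ord0 i) s (y ord0 i).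

Definition mala_log_ratio V s x y : R :=
  V x - V y + ln (mala_density V s y x / mala_density V s x y).

(* [mala F V s g x] is E[g(X_{k+1}) | X_k = x] for [0 <= g]. *)
Definition mala F V s (g : 'rV[R]_n -> \bar R) x : \bar R :=
  (\int[lebesgue_rV n]_y
     ((mala_density V s x y)%:E *
        ((F (mala_log_ratio V s x y))%:E * g y +
         (1 - F (mala_log_ratio V s x y))%:E * g x)))%E.

End mala.

(* Dirichlet-form expression of the spectral gap of a Markov operator [T] that
   is reversible with respect to [mu]; the inner application of [T] is
   E[|f(X_{k+1}) - f(X_k)|^2 | X_k = x]. *)
Definition gap d (X : measurableType d) (R : realType) (mu : probability X R)
    (T : (X -> \bar R) -> X -> \bar R) : \bar R :=
  ereal_inf
    [set ((\int[mu]_x T (fun y => (`|f y - f x| ^+ 2)%:E) x) /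
          (2%:E * 'V_mu[f]))%E
    | f in [set f : X -> R | f \in Lfun mu 2%:E /\ (0 < 'V_mu[f])%E]].

Definition cos_potential (R : realType) n (A l : 'I_n -> R) (eps : R)
    (x : 'rV[R]_n) : R :=
  \sum_(i < n) A i * cos (x ord0 i / (l i * eps)).

(* Main.v *)
Require Import Defs.
From mathcomp Require Import all_boot all_order all_algebra.
From mathcomp Require Import all_classical all_reals all_analysis.
From mathcomp Require Import measurable_realfun.
From mathcomp Require Import ring lra.

Import Order.TTheory GRing.Theory Num.Theory.
Import numFieldNormedType.Exports.

Local Open Scope classical_set_scope.
Local Open Scope ring_scope.

(** The gap is tested on the indicator of a cube [B]. With [q] the proposal
density, the accepted stationary flow from [x] to [y] is at most
[min (e^{-V x} q(x,y)) (e^{-V y} q(y,x)) / Z], so no integration against the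
acceptance rule is needed.

If [alpha < 1/2], take [B] near the origin, of side of order [eps], where the
sine in the derivative of the oscillating part of [V] is at least [1/2]. The
drift [s^2/2 V'] is then of order [eps^(2 alpha - 1)], which tends to infinity:
from [B] the proposal either stays at bounded distance, a Gaussian tail event,
or lands where [e^{-V}] is tiny. Both are exponentially small in
[eps^(2 alpha - 1)], hence negligible against the power
[eps^(n (2 theta - alpha))].

If [1/2 <= alpha], the hypothesis on the exponents forces [theta < 0], so this
power is at least [1] for [eps <= 1], and any bound on the gap that is uniform
in [eps] suffices. *)

(** * Integration against a density *)

Section integration.
Set Implicit Arguments.
Unset Strict Implicit.
Local Open Scope ereal_scope.
Context d (T : measurableType d) (R : realType).
Implicit Types m nu : {measure set T -> \bar R}.

(* Unlike [ge0_le_integral], no measurability: the integral of a nonnegative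
   function is a supremum over the simple functions below it. *)
Lemma ge0_le_integralT m (f g : T -> \bar R) :
  (forall x, 0 <= f x) -> (forall x, f x <= g x) ->
  \int[m]_x f x <= \int[m]_x g x.
Proof.
move=> f0 fg; rewrite !ge0_integralTE//; last first.
  by move=> x; exact: le_trans (f0 x) (fg x).
apply: ge_ereal_sup => _ [h /= hf <-]; apply: ereal_sup_ubound.
by exists h => //= x; exact: le_trans (hf x) (fg x).
Qed.

Import HBNNSimple.

(** Indicators first, then simple functions by linearity, then monotone convergence. [nu] is only
    required to agree with [w dm] on measurable sets, so this applies to the Gibbs measure although
    it is built by normalization. *)
Lemma ge0_integral_density m nu (w : T -> R) :
  measurable_fun setT w -> (forall x, 0 <= w x)%R ->
  (forall A, measurable A -> nu A = \int[m]_(x in A) (w x)%:E) ->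
  forall f : T -> \bar R, measurable_fun setT f -> (forall x, 0 <= f x) ->
  \int[nu]_x f x = \int[m]_x (f x * (w x)%:E).
Proof.
move=> mw w0 nuE f mf f0.
have indicE E : measurable E ->
    \int[nu]_x (\1_E x)%:E = \int[m]_x ((\1_E x)%:E * (w x)%:E).
  move=> mE; rewrite integral_indic// setIT nuE// integral_mkcond.
  apply: eq_integral => x _; rewrite patchE indicE.
  by case: (x \in E); rewrite ?mul1e ?mul0e.
have simpleE (h : {nnsfun T >-> R}) :
    \int[nu]_x (h x)%:E = \int[m]_x ((h x)%:E * (w x)%:E).
  under [LHS]eq_integral do rewrite fimfunE -fsumEFin//.
  rewrite [LHS]ge0_integral_fsum//; last 2 first.
    - by move=> r; exact/measurable_EFinP/measurableT_comp.
    - by move=> n x _; rewrite EFinM nnfun_muleindic_ge0.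
  under [RHS]eq_integral.
    move=> x xD; rewrite fimfunE -fsumEFin// ge0_mule_fsuml; last first.
      by move=> r; apply: nnfun_muleindic_ge0.
    over.
  rewrite [RHS]ge0_integral_fsum//; last 2 first.
    - move=> r; apply: emeasurable_funM; last exact/measurable_EFinP.
      by apply/measurable_EFinP; do 2 apply/measurableT_comp => //.
    - move=> n x _; apply: mule_ge0; last by rewrite lee_fin.
      by rewrite EFinM nnfun_muleindic_ge0.
  apply: eq_fsbigr => r _; rewrite integralZl_indic_nnsfun//=.
  rewrite indicE//.
  under [RHS]eq_integral do rewrite EFinM -muleA.
  (* Only a nonnegative constant is pulled out of the integral; a nonnegative simple function has no
     negative value, so for [r < 0] the preimage is empty and both sides vanish. *)
  have [r0|r0] := leP 0%R r.
    rewrite ge0_integralZl//.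
    - apply: emeasurable_funM => //; exact/measurable_EFinP.
    - by move=> x _; rewrite mule_ge0 ?lee_fin.
  rewrite (preimage_nnfun0 h r0).
  by rewrite !integral0_eq ?mule0// => x _; rewrite indic0 !(mul0e,mule0).
pose f_ := nnsfun_approx measurableT mf.
have cvgf x : (EFin \o f_ ^~ x) n @[n --> \oo] --> f x.
  exact: cvg_nnsfun_approx.
transitivity (limn (fun n => \int[nu]_x (f_ n x)%:E)).
  rewrite -monotone_convergence//=.
  - by apply: eq_integral => x _; apply/esym/cvg_lim => //=; exact: cvgf.
  - by move=> n; apply: measurableT_comp => //; exact: measurable_funTS.
  - by move=> n x _; rewrite lee_fin.
  - by move=> x _ a b ab; rewrite lee_fin//; exact/lefP/nd_nnsfun_approx.
under eq_fun do rewrite simpleE.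
rewrite -monotone_convergence//=.
- apply: eq_integral => x _; apply/cvg_lim => //=.
  by apply: cvgeZr => //; exact: cvgf.
- by move=> n; apply: emeasurable_funM => //; apply/measurable_EFinP.
- by move=> n x _; rewrite mule_ge0 ?lee_fin.
- move=> x _ a b ab; apply: lee_wpmul2r => //; rewrite lee_fin//.
  exact/lefP/nd_nnsfun_approx.
Qed.

End integration.

(** * Measurability and integrals of product functions on R^n *)

Section row_vectors.
Set Implicit Arguments.
Unset Strict Implicit.
Context {R : realType}.

(** The sigma-algebra is generated by coordinates, so an open set has to be exhibited as a countable
    union of boxes: those cubes [K q k] with rational centre and half-side [1 / (k + 1)] that it
    contains. *)
Lemma continuous_measurable_rV n (f : 'rV[R]_n -> R) :
  continuous f -> measurable_fun [set: 'rV[R]_n] f.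
Proof.
move=> cf; apply: (measurability _ (@RGenOpens.measurableE R)) => //.
move=> _ [_ [a [b ->]] <-]; rewrite setTI.
set U := f @^-1` _.
have oU : open U by apply: open_comp => [x _|]; [exact: cf|exact: interval_open].
pose K (q : 'rV[rat]_n) (k : nat) := [set x : 'rV[R]_n |
  forall i, [set t : R | `|t - ratr (q ord0 i)| < k.+1%:R^-1] (x ord0 i)].
rewrite (_ : U = \bigcup_(z : 'rV[rat]_n * nat)
    (if `[< K z.1 z.2 `<=` U >] then K z.1 z.2 else set0)).
  apply: countable_bigcupT_measurable; first exact: countableP.
  move=> -[q k] /=.
  case: ifP => // _.
  apply: (@measurable_box R n
    (fun i => [set t | `|t - ratr (q ord0 i)| < _])) => i.
  rewrite (_ : [set t | _] = `]ratr (q ord0 i) - k.+1%:R^-1,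
      ratr (q ord0 i) + k.+1%:R^-1[%classic); first exact: measurable_itv.
  by apply/seteqP; split => t /=; rewrite in_itv/= ltr_distl.
apply/seteqP; split => x; last first.
  by move=> [[q k] _]; case: asboolP => // /[apply].
move=> Ux; have /nbhs_ballP[e /= e0 xU] := open_nbhs_nbhs (conj oU Ux).
(* The centre is within the half-side of [x], hence every point of the cube is within two half-sides
   of [x]; half of [e] is the right threshold. *)
have [k ke] : exists k : nat, k.+1%:R^-1 < e / 2.
  have [|k] := @ltr_add_invr R 0 (e / 2); first by rewrite divr_gt0.
  by rewrite add0r; exists k.
have k0 : 0 < k.+1%:R^-1 :> R by rewrite invr_gt0.
have qP i : exists r : rat, `|x ord0 i - ratr r| < k.+1%:R^-1.
  have [|r] := @rat_in_itvoo R (x ord0 i - k.+1%:R^-1) (x ord0 i + k.+1%:R^-1).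
    by rewrite ltrBlDr -addrA ltrDl addr_gt0.
  by rewrite in_itv/= -ltr_distl distrC => ?; exists r.
exists (\row_i sval (cid (qP i)), k) => //=.
have Kx : K (\row_i sval (cid (qP i))) k x.
  by move=> i /=; rewrite mxE; case: cid.
rewrite ifT//; apply/asboolP => y Ky; apply: xU; split => // i j.
rewrite (ord1 i) -[0]/ord0 -ball_normE /ball_/=; have /= := Kx j; have /= := Ky j.
move: ke; set h := k.+1%:R^-1 => ke; set r := ratr _.
rewrite !ltr_distl => /andP[? ?] /andP[? ?].
by apply/andP; split; lra.
Qed.

Local Open Scope ereal_scope.

Lemma measurable_prod_rV n (f : 'I_n -> R -> R) :
  (forall i, measurable_fun setT (f i)) ->
  measurable_fun [set: 'rV[R]_n] (fun x => \prod_i f i (x ord0 i))%R.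
Proof.
move=> mf; apply: measurable_prod => i _.
exact: (measurableT_comp (mf i) (measurable_coord i)).
Qed.

(** Induction on [n]: Lebesgue measure on R^(n+1) is the image of a product measure under [cons_rV],
    so Tonelli splits off the first coordinate. In dimension 0 the measure is a Dirac mass and the
    product is empty. *)
Lemma integral_prod_rV n (f : 'I_n -> R -> R) :
  (forall i, measurable_fun setT (f i)) -> (forall i t, 0 <= f i t)%R ->
  \int[lebesgue_rV n]_x (\prod_i f i (x ord0 i))%:E =
  \prod_i \int[lebesgue_measure]_t (f i t)%:E.
Proof.
elim: n f => [|n IH] f mf f0.
  rewrite big_ord0 /= integral_dirac//; last first.
    by apply/measurable_EFinP; apply: measurable_prod_rV.
  by rewrite diracT mul1e big_ord0.
rewrite big_ord_recl -IH//= /cons_measure.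
have mF : measurable_fun [set: 'rV[R]_n.+1]
    (fun x => (\prod_i f i (x ord0 i))%:E).
  by apply/measurable_EFinP; apply: measurable_prod_rV.
have F0 (x : 'rV[R]_n.+1) : 0 <= (\prod_i f i (x ord0 i))%:E.
  by rewrite lee_fin prodr_ge0.
have mc : measurable_fun setT (@cons_rV R n) := @measurable_cons_rV R n.
rewrite ge0_integral_pushforward// preimage_setT.
rewrite fubini_tonelli1//; [|exact: (measurableT_comp mF mc)|by move=> z; exact: F0].
have mG : measurable_fun [set: 'rV[R]_n]
    (fun x => (\prod_i f (lift ord0 i) (x ord0 i))%:E).
  apply/measurable_EFinP.
  exact: (@measurable_prod_rV _ (fun i => f (lift ord0 i))).
have G0 (x : 'rV[R]_n) : 0 <= (\prod_i f (lift ord0 i) (x ord0 i))%:E.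
  by rewrite lee_fin prodr_ge0.
have mf0 : measurable_fun [set: R] (fun t => (f ord0 t)%:E).
  by apply/measurable_EFinP; exact: mf.
rewrite -ge0_integralZr//; last 2 first.
- by move=> t _; rewrite lee_fin.
- by apply: integral_ge0 => x _; exact: G0.
apply: eq_integral => a _; rewrite /fubini_F -ge0_integralZl//; last first.
  by rewrite lee_fin.
apply: eq_integral => x _ /=; rewrite big_ord_recl -EFinM mxE unlift_none.
by congr (_ * _)%:E; apply: eq_bigr => i _; rewrite mxE liftK.
Qed.

(** On the positive half-line the integrand is [1 / c] times the exponential density, of mass 1; the
    reflection [t -> - t] handles the other half. *)
Lemma integral_expR_normr (c : R) : (0 < c)%R ->
  \int[lebesgue_measure]_t (expR (- (c * `|t|)))%:E \is a fin_num.
Proof.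
move=> c0; rewrite ge0_fin_numE; last first.
  by apply: integral_ge0 => t _; rewrite lee_fin expR_ge0.
have me : measurable_fun [set: R] (fun t => expR (- (c * `|t|))).
  apply: measurableT_comp => //; apply: measurableT_comp => //.
  by apply: measurable_funM => //; exact: measurableT_comp.
have mE := (measurable_EFinP _ _).2 me.
have half : \int[lebesgue_measure]_(t in `[0%R, +oo[) (expR (- (c * `|t|)))%:E
    <= c^-1%:E.
  rewrite -[leRHS]mule1 -(integral_exponential_pdf c0).
  have mp := @measurable_exponential_pdf R c.
  rewrite -ge0_integralZl//; last 3 first.
  - exact/measurable_EFinP.
  - by move=> t _; rewrite lee_fin exponential_pdf_ge0// ltW.
  - by rewrite lee_fin invr_ge0 ltW.
  rewrite [leLHS]integral_mkcond; apply: ge0_le_integralT => t; rewrite patchE.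
    by case: ifP => // _; rewrite lee_fin expR_ge0.
  case: ifP => [|_]; last first.
    by rewrite mule_ge0 ?lee_fin ?invr_ge0 ?exponential_pdf_ge0// ltW.
  rewrite inE/= in_itv/= andbT => t0.
  by rewrite exponential_pdfE// -EFinM mulKf ?gt_eqF// ger0_norm// mulNr.
have -> : [set: R] = `]-oo, 0%R]%classic `|` `]0%R, +oo[%classic.
  by rewrite -setCitvl setUv.
have f0 t : 0 <= (expR (- (c * `|t|)))%:E by rewrite lee_fin expR_ge0.
rewrite ge0_integral_setU//; last 2 first.
- exact: measurable_funTS.
- by rewrite -setCitvl; exact/disj_setPCl.
rewrite (@le_lt_trans _ _ (c^-1%:E + c^-1%:E))// -?EFinD ?ltry// EFinD.
apply: leeD.
  apply: le_trans half; rewrite ge0_integration_by_substitution0//.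
  by under [leRHS]eq_integral do rewrite normrN.
apply: le_trans half; apply: ge0_subset_integral => //.
  exact: measurable_funTS.
by move=> t /=; rewrite !in_itv/= !andbT => /ltW.
Qed.

End row_vectors.

(** * Bounding the gap by one indicator function *)

Section gap_upper_bound.
Set Implicit Arguments.
Unset Strict Implicit.
Local Open Scope ereal_scope.

Lemma Lfun_indic d (T : measurableType d) (R : realType)
    (P : probability T R) (B : set T) (r : R) :
  measurable B -> \1_B \in Lfun P r%:E.
Proof.
move=> mB; rewrite inE; apply/andP; split; rewrite inE/=.
  exact: measurable_indic.
rewrite /finite_norm unlock poweR_lty//.
apply: (@le_lt_trans _ _ (\int[P]_x cst 1 x)); last first.
  rewrite integral_cst// mul1e.
  by apply: (le_lt_trans (probability_le1 P measurableT)); exact: ltry.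
apply: ge0_le_integralT => x; first by rewrite lee_fin powR_ge0.
rewrite lee_fin /= indicE; case: (_ \in _); rewrite ?normr1 ?powR1// normr0.
by have [->|r0] := eqVneq r 0%R; rewrite ?powRr0// powR0.
Qed.

Lemma variance_indic d (T : measurableType d) (R : realType)
    (P : probability T R) (B : set T) :
  measurable B -> 'V_P[\1_B] = P B * P (~` B).
Proof.
move=> mB; rewrite varianceE; last exact: Lfun_indic.
have -> : ((\1_B : T -> R) ^+ 2 = \1_B)%R.
  apply/funext => x; rewrite expr2 fctE indicE.
  by case: (_ \in _); rewrite ?mulr1 ?mulr0.
rewrite expectation_indic// probability_setC//.
have PBf : P B \is a fin_num by rewrite fin_num_measure.
by rewrite muleBr ?mule1 -?expe2// fin_num_adde_defl.
Qed.

Lemma gap_le_indic d (T : measurableType d) (R : realType)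
    (P : probability T R) (K : (T -> \bar R) -> T -> \bar R) (B : set T)
    (b c D : R) :
  measurable B -> (0 < b)%R -> (0 < c)%R ->
  b%:E <= P B -> c%:E <= P (~` B) ->
  0 <= \int[P]_x K (fun y => (`|\1_B y - \1_B x| ^+ 2)%:E) x <= D%:E ->
  gap P K <= (D / (2 * (b * c)))%:E.
Proof.
move=> mB b0 c0 bP cP /andP[K0 KD].
have PBf : P B \is a fin_num by rewrite fin_num_measure.
have PCf : P (~` B) \is a fin_num by rewrite fin_num_measure//; exact: measurableC.
rewrite -(fineK PBf) lee_fin in bP; rewrite -(fineK PCf) lee_fin in cP.
have VE : 'V_P[\1_B] = (fine (P B) * fine (P (~` B)))%:E.
  by rewrite variance_indic// EFinM !fineK.
have bc : (b * c <= fine (P B) * fine (P (~` B)))%R by rewrite ler_pM// ltW.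
have bc0 : (0 < b * c)%R by rewrite mulr_gt0.
apply: (@le_trans _ _ ((\int[P]_x K (fun y => (`|\1_B y - \1_B x| ^+ 2)%:E) x)
    / (2%:E * 'V_P[\1_B]))).
  apply: ereal_inf_lbound; exists \1_B => //; split.
    exact: Lfun_indic.
  by rewrite VE lte_fin (lt_le_trans bc0).
rewrite VE -EFinM inver gt_eqF; last by rewrite mulr_gt0// (lt_le_trans bc0).
rewrite EFinM; apply: lee_pmul => //.
  by rewrite lee_fin invr_ge0 mulr_ge0// (le_trans (ltW bc0)).
rewrite lee_fin lef_pV2 ?ler_pM2l// posrE mulr_gt0//.
exact: lt_le_trans bc.
Qed.

End gap_upper_bound.

(** * The Gibbs measure with a finite partition function *)

Section gibbs_measure.
Set Implicit Arguments.
Unset Strict Implicit.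
Local Open Scope ereal_scope.
Context {R : realType} {n : nat}.
Variables (V : 'rV[R]_n -> R) (Z : R).
Hypotheses (mV : measurable_fun setT V) (Z0 : (0 < Z)%R).
Hypothesis ZE : \int[lebesgue_rV n]_x (expR (- V x))%:E = Z%:E.

Let measurable_weight : measurable_fun setT (fun x => expR (- V x)).
Proof. by apply: measurableT_comp => //; exact: measurableT_comp. Qed.

Lemma gibbsE A : measurable A ->
  gibbs V A = \int[lebesgue_rV n]_(x in A) (expR (- V x) / Z)%:E.
Proof.
move=> mA; rewrite /gibbs /= /mnormalize /= /density_measure.
case: asboolP => [_|[]]; last by split => // x; exact: expR_ge0.
(* As the total mass [Z] is finite and nonzero, [mnormalize] divides by it and the default Dirac
   mass does not arise. *)
rewrite ZE eqe gt_eqF//=.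
under [RHS]eq_integral do rewrite EFinM.
rewrite ge0_integralZr//.
- by apply/measurable_EFinP; exact: measurable_funTS.
- by rewrite lee_fin invr_ge0 ltW.
Qed.

(** The factor [expR (V x)] cancels the Gibbs weight; the pointwise flow bound [mala_flow_le]
    carries exactly this factor. *)
Lemma integral_gibbs (f : 'rV[R]_n -> R) :
  measurable_fun setT f -> (forall x, 0 <= f x)%R ->
  \int[gibbs V]_x (expR (V x) * f x)%:E =
  (\int[lebesgue_rV n]_x (f x)%:E) * (Z^-1)%:E.
Proof.
move=> mf f0.
rewrite (@ge0_integral_density _ _ _ (lebesgue_rV n) (gibbs V)
    (fun x => expR (- V x) / Z)%R); last 5 first.
- exact: measurable_funM.
- by move=> x; rewrite divr_ge0 ?expR_ge0// ltW.
- by move=> A mA; exact: gibbsE.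
- apply/measurable_EFinP; apply: measurable_funM => //.
  exact: measurableT_comp.
- by move=> x; rewrite lee_fin mulr_ge0 ?expR_ge0.
rewrite -ge0_integralZr//; last 3 first.
- exact/measurable_EFinP.
- by move=> x _; rewrite lee_fin.
- by rewrite lee_fin invr_ge0 ltW.
apply: eq_integral => x _; rewrite -!EFinM; congr EFin.
by rewrite mulrACA -expRD subrr expR0 mul1r.
Qed.

Lemma gibbs_ge A (M v : R) : measurable A -> lebesgue_rV n A = v%:E ->
  (forall x, A x -> V x <= M)%R -> (v * expR (- M) / Z)%:E <= gibbs V A.
Proof.
move=> mA Av AM; rewrite gibbsE// -mulrA mulrC EFinM -Av.
rewrite -integral_cst//; apply: ge0_le_integral => //.
- by move=> x _; rewrite lee_fin divr_ge0 ?expR_ge0// ltW.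
- apply/measurable_EFinP; apply: measurable_funTS.
  exact: measurable_funM.
- move=> x Ax; rewrite lee_fin; apply: ler_wpM2r; first by rewrite invr_ge0 ltW.
  by rewrite ler_expR lerN2 AM.
Qed.

End gibbs_measure.

(** * The stationary MALA flow across the boundary of a set *)

Lemma accepted_flow_le (R : realType) (a b u v f : R) :
  0 < u -> 0 < v -> f <= 1 -> f <= expR (a - b + ln (v / u)) ->
  u * f <= expR a * Num.min (expR (- a) * u) (expR (- b) * v).
Proof.
move=> u0 v0 f1; rewrite expRD lnK ?posrE ?divr_gt0// => fe.
(* The two entries of the minimum are handled separately: the first uses [f <= 1], the second the
   bound of [f] by the exponential of the log ratio. *)
rewrite minr_pMr ?expR_ge0// le_min !mulrA -!expRD subrr expR0 mul1r.
rewrite ler_piMr ?(ltW u0)//= mulrC -ler_pdivlMr// -mulrA.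
exact: fe.
Qed.

Section kernel.
Set Implicit Arguments.
Unset Strict Implicit.
Local Open Scope ereal_scope.
Context {R : realType} {n : nat}.
Variables (V : 'rV[R]_n -> R) (Z s : R) (F : R -> R).
Hypotheses (mV : measurable_fun setT V) (Z0 : (0 < Z)%R) (s0 : (0 < s)%R).
Hypothesis ZE : \int[lebesgue_rV n]_x (expR (- V x))%:E = Z%:E.
Hypothesis F_acc : F = metropolis \/ F = barker.

Local Notation q := (mala_density V s).

(** The Metropolis and Barker rules enter the estimates only through [0 <= F r], [F r <= 1] and
    [F r <= expR r]. *)
Lemma acceptance_ge0 r : (0 <= F r)%R.
Proof.
case: F_acc => ->; first by rewrite /metropolis le_min ler01 expR_ge0.
by rewrite /barker invr_ge0 addr_ge0 ?expR_ge0.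
Qed.

Lemma acceptance_le1 r : (F r <= 1)%R.
Proof.
case: F_acc => ->; first by rewrite /metropolis ge_min lexx.
by rewrite /barker invf_le1 ?lerDl ?addr_gt0 ?expR_ge0 ?expR_gt0.
Qed.

Lemma acceptance_le_expR r : (F r <= expR r)%R.
Proof.
case: F_acc => ->; first by rewrite /metropolis ge_min lexx orbT.
rewrite /barker -[leRHS]invrK -expRN lef_pV2 ?posrE ?addr_gt0 ?expR_gt0//.
by rewrite lerDr.
Qed.

Lemma mala_density_gt0 x y : (0 < q x y)%R.
Proof.
apply: prodr_gt0 => i _; rewrite normal_pdfE ?gt_eqF//.
by rewrite mulr_gt0 ?normal_peak_gt0 ?gt_eqF ?expR_gt0.
Qed.

Lemma integral_mala_density x : \int[lebesgue_rV n]_y (q x y)%:E = 1.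
Proof.
rewrite (@integral_prod_rV _ _ (fun i => normal_pdf (mala_mean V s x ord0 i) s)).
- by rewrite big1// => i _; exact: integral_normal_pdf.
- by move=> i; exact: measurable_normal_pdf.
- by move=> i t; exact: normal_pdf_ge0.
Qed.

Lemma mala_flow_le x y : (q x y * F (mala_log_ratio V s x y) <=
  expR (V x) * Num.min (expR (- V x) * q x y) (expR (- V y) * q y x))%R.
Proof.
by apply: (@accepted_flow_le R (V x) (V y)); [exact: mala_density_gt0|
  exact: mala_density_gt0|exact: acceptance_le1|exact: acceptance_le_expR].
Qed.

Lemma mala_indic_ge0 B x :
  0 <= mala F V s (fun y => (`|\1_B y - \1_B x| ^+ 2)%:E) x.
Proof.
apply: integral_ge0 => y _; apply: mule_ge0.
  by rewrite lee_fin ltW// mala_density_gt0.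
by apply: adde_ge0; apply: mule_ge0; rewrite lee_fin ?exprn_ge0//
  ?acceptance_ge0// subr_ge0 acceptance_le1.
Qed.

Lemma mala_indic_le B x (k : 'rV[R]_n -> R) :
  (forall y, q x y * (F (mala_log_ratio V s x y) * (\1_B y - \1_B x) ^+ 2)
             <= k y)%R ->
  mala F V s (fun y => (`|\1_B y - \1_B x| ^+ 2)%:E) x <=
  \int[lebesgue_rV n]_y (k y)%:E.
Proof.
move=> qk; apply: ge0_le_integralT => y.
  apply: mule_ge0; first by rewrite lee_fin ltW// mala_density_gt0.
  by apply: adde_ge0; apply: mule_ge0; rewrite lee_fin ?exprn_ge0//
    ?acceptance_ge0// subr_ge0 acceptance_le1.
(* After a rejection the chain stays at [x], where the increment of the indicator is 0, so the
   rejection term drops out. *)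
rewrite subrr normr0 expr0n mule0 adde0 -!EFinM lee_fin.
by rewrite real_normK ?num_real.
Qed.

Lemma mala_indic_le1 B x :
  mala F V s (fun y => (`|\1_B y - \1_B x| ^+ 2)%:E) x <= 1.
Proof.
rewrite -(integral_mala_density x); apply: mala_indic_le => y.
apply: ler_piMr; first exact/ltW/mala_density_gt0.
rewrite mulr_ile1 ?acceptance_ge0 ?acceptance_le1 ?sqr_ge0//.
Qed.

Lemma dirichlet_indic_le1 B :
  \int[gibbs V]_x mala F V s (fun y => (`|\1_B y - \1_B x| ^+ 2)%:E) x <= 1%E.
Proof.
rewrite -(@probability_setT _ _ _ (gibbs V)) -[leRHS]mul1e.
rewrite -integral_cst//; apply: ge0_le_integralT => x.
  exact: mala_indic_ge0.
exact: mala_indic_le1.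
Qed.

(** The minimum is symmetric in its two points, so leaving and entering [B] obey the same bound [h],
    evaluated at the endpoint outside [B]. Each direction contributes [v * I / Z]. *)
Lemma dirichlet_indic_le B (h : 'rV[R]_n -> R) (I v : R) :
  measurable B -> lebesgue_rV n B = v%:E ->
  measurable_fun setT h -> (forall x, 0 <= h x)%R ->
  \int[lebesgue_rV n]_x (h x)%:E = I%:E ->
  (forall b z, B b ->
    Num.min (expR (- V b) * q b z) (expR (- V z) * q z b) <= h z)%R ->
  \int[gibbs V]_x mala F V s (fun y => (`|\1_B y - \1_B x| ^+ 2)%:E) x <=
  (2 * v * I / Z)%:E.
Proof.
move=> mB Bv mh h0 hI Bh.
have mB1 : measurable_fun [set: 'rV[R]_n] (\1_B : _ -> R).
  exact: measurable_indic.
have I0 : (0 <= I)%R.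
  by rewrite -lee_fin -hI; apply: integral_ge0 => x _; rewrite lee_fin.
have v0 : (0 <= v)%R by rewrite -lee_fin -Bv.
have iB : \int[lebesgue_rV n]_y (\1_B y)%:E = v%:E.
  by rewrite integral_indic// setIT; exact: Bv.
have lin a b : (0 <= a)%R -> (0 <= b)%R ->
    \int[lebesgue_rV n]_y (a * h y + b * \1_B y)%:E = (a * I + b * v)%:E.
  move=> a0 b0; under eq_integral do rewrite EFinD !EFinM.
  have mh' : measurable_fun setT (EFin \o h) by exact/measurable_EFinP.
  have mB' : measurable_fun setT (EFin \o (\1_B : 'rV[R]_n -> R)).
    exact/measurable_EFinP.
  have h0' y : 0 <= (h y)%:E by rewrite lee_fin.
  have B0' (y : 'rV[R]_n) : 0 <= (\1_B y : R)%:E by rewrite lee_fin.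
  have ah0 y : 0 <= a%:E * (h y)%:E by rewrite mule_ge0// lee_fin.
  have bB0 (y : 'rV[R]_n) : 0 <= b%:E * (\1_B y)%:E by rewrite mule_ge0// lee_fin.
  have mah : measurable_fun setT (fun y => a%:E * (h y)%:E).
    exact: measurable_funeM.
  have mbB : measurable_fun setT (fun y : 'rV[R]_n => b%:E * (\1_B y)%:E).
    exact: measurable_funeM.
  rewrite ge0_integralD//.
  by rewrite ge0_integralZl// ge0_integralZl// hI iB -!EFinM -EFinD.
(* [expR (V x) * H x] is the pointwise bound [expR (V x) * (\1_B x * h y + h x * \1_B y)] integrated
   over [y]. *)
pose H x := (v * h x + I * \1_B x)%R.
have H0 x : (0 <= H x)%R by rewrite addr_ge0 ?mulr_ge0.
have kH x : mala F V s (fun y => (`|\1_B y - \1_B x| ^+ 2)%:E) x <=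
    (expR (V x) * H x)%:E.
  apply: (@le_trans _ _ (\int[lebesgue_rV n]_y
      (expR (V x) * \1_B x * h y + expR (V x) * h x * \1_B y)%:E)).
    apply: mala_indic_le => y; rewrite -!mulrA -mulrDr [(h x * _)%R]mulrC.
    have e0 : (0 <= expR (V x) * (\1_B x * h y + \1_B y * h x))%R.
      by rewrite mulr_ge0 ?expR_ge0// addr_ge0// mulr_ge0.
    have := mala_flow_le x y; move: e0; rewrite mulrA !indicE.
    (* The increment is nonzero only when exactly one of [x] and [y] is in [B]; for a move into [B]
       the hypothesis on [h] applies after swapping the minimum. *)
    case: (boolP (x \in B)) => xB; case: (boolP (y \in B)) => yB;
      rewrite /= ?mulr1n ?mulr0n ?subrr ?subr0 ?sub0r ?sqrrN ?expr1n ?expr0n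
        /= ?mulr0 ?mulr1 ?mul1r ?mul0r ?addr0 ?add0r ?mulr0 => e0 fl.
    - exact: e0.
    - apply: (le_trans fl); rewrite ler_pM2l ?expR_gt0//.
      by apply: Bh; exact/set_mem.
    - apply: (le_trans fl); rewrite ler_pM2l ?expR_gt0// minC.
      by apply: Bh; exact/set_mem.
    - exact: lexx.
  rewrite lin; [|by rewrite mulr_ge0 ?expR_ge0..].
  by rewrite lee_fin /H le_eqVlt; apply/orP; left; apply/eqP; ring.
apply: (@le_trans _ _ (\int[gibbs V]_x (expR (V x) * H x)%:E)).
  by apply: ge0_le_integralT => x; [exact: mala_indic_ge0|exact: kH].
rewrite (integral_gibbs mV Z0 ZE)//; last first.
  by apply: measurable_funD; apply: measurable_funM.
rewrite lin// -EFinM lee_fin le_eqVlt; apply/orP; left; apply/eqP; ring.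
Qed.

End kernel.

(** * Gaussian tails and exponential estimates *)

Section estimates.
Set Implicit Arguments.
Unset Strict Implicit.
Context {R : realType}.

(** Trades growth of order [p] for linear growth up to a constant, so that [e^{-V}] is dominated by
    a product of exponentials. *)
Lemma normr_le1D_powR (p t : R) : 1 <= p -> `|t| - 1 <= `|t| `^ p.
Proof.
move=> p1; have [t1|t1] := leP 1 `|t|.
  rewrite (@le_trans _ _ `|t|)//; first by rewrite gerBl.
  by rewrite -[leLHS]powRr1// ler_powR.
by rewrite (@le_trans _ _ 0) ?powR_ge0// subr_le0 ltW.
Qed.

Lemma prod_expR_normr n (c : R) (z : 'rV[R]_n) :
  \prod_i expR (- (c * `|z ord0 i|)) = expR (- (c * \sum_i `|z ord0 i|)).
Proof. by rewrite mulr_sumr -sumrN expR_sum. Qed.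

Lemma normal_peak_le (s : R) : 0 < s -> normal_peak s <= s^-1.
Proof.
move=> s0; rewrite /normal_peak lef_pV2 ?posrE ?sqrtr_gt0//; last first.
  by rewrite mulrn_wgt0// mulr_gt0 ?pi_gt0// exprn_gt0.
rewrite -[leLHS]ger0_norm ?(ltW s0)// -sqrtr_sqr ler_sqrt; last first.
  by rewrite mulrn_wge0// mulr_ge0 ?pi_ge0// sqr_ge0.
rewrite -mulrnAr ler_peMr ?sqr_ge0//.
by rewrite mulr2n; have := pi_ge2 R; lra.
Qed.

(** Since [s <= 1], the exponent [(t - m)^2 / (2 s^2)] is at least [L^2 / 2], a rate free of [s]. *)
Lemma normal_pdf_tail (m s t L : R) : 0 < s <= 1 -> 0 <= L -> L <= `|t - m| ->
  normal_pdf m s t <= normal_peak s * expR (- (L ^+ 2 / 2)).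
Proof.
move=> /andP[s0 s1] L0 Lt; rewrite normal_pdfE ?gt_eqF//.
rewrite ler_wpM2l ?normal_peak_ge0// ler_expR mulNr lerN2.
have L2 : L ^+ 2 <= (t - m) ^+ 2.
  by rewrite -[leRHS]real_normK ?num_real// lerXn2r ?nnegrE.
apply: ler_pM; rewrite ?sqr_ge0//.
rewrite lef_pV2 ?posrE ?mulrn_wgt0 ?exprn_gt0// mulr2n.
have : s ^+ 2 <= 1 by rewrite expr_le1// ltW.
lra.
Qed.

Lemma mala_density_le n (V : 'rV[R]_n -> R) (s : R) (x y : 'rV[R]_n) : 0 < s ->
  mala_density V s x y <= normal_peak s ^+ n.
Proof.
move=> s0; rewrite -[X in _ ^+ X](card_ord n) -prodr_const.
apply: ler_prod => i _; rewrite normal_pdf_ge0 normal_pdf_ub//.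
by rewrite gt_eqF.
Qed.

Lemma mala_density_tail n (V : 'rV[R]_n -> R) (s L : R) (x y : 'rV[R]_n)
    (i : 'I_n) :
  0 < s <= 1 -> 0 <= L -> L <= `|y ord0 i - mala_mean V s x ord0 i| ->
  mala_density V s x y <= normal_peak s ^+ n * expR (- (L ^+ 2 / 2)).
Proof.
move=> s01 L0 Li; have /andP[s0 s1] := s01.
(* Only coordinate [i] is known to be far from its mean; the other factors are bounded by the
   peak. *)
have -> : normal_peak s ^+ n * expR (- (L ^+ 2 / 2)) =
    \prod_(j < n) (normal_peak s * (if j == i then expR (- (L ^+ 2 / 2)) else 1)).
  rewrite big_split/= prodr_const card_ord; congr (_ * _).
  by rewrite -big_mkcond/= big_pred1_eq.
apply: ler_prod => j _; rewrite normal_pdf_ge0/=.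
case: eqP => [->|_]; first exact: normal_pdf_tail.
by rewrite mulr1 normal_pdf_ub// gt_eqF.
Qed.

(** The rate [c] is halved: one half gives smallness in [L], the other is kept as decay in [z] so
    that the bound is integrable over [z]. *)
Lemma mala_flow_tail n (V : 'rV[R]_n -> R) (s c K L : R) (i : 'I_n)
    (b z : 'rV[R]_n) :
  0 < s <= 1 -> 0 < c -> 0 <= K ->
  (forall x : 'rV[R]_n,
    expR (- V x) <= K * \prod_i expR (- (c * `|x ord0 i|))) ->
  2 * c <= L -> 2 * L <= `|mala_mean V s b ord0 i| ->
  Num.min (expR (- V b) * mala_density V s b z)
          (expR (- V z) * mala_density V s z b) <=
  K * normal_peak s ^+ n * expR (- (c / 2 * L)) *
    \prod_i expR (- (c / 2 * `|z ord0 i|)).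
Proof.
move=> s01 c0 K0 KV cL Lb; have /andP[s0 s1] := s01.
have L0 : 0 <= L by apply: le_trans cL; rewrite mulr_ge0// ltW.
rewrite prod_expR_normr -!mulrA -expRD.
set S := \sum_i _.
have S0 : 0 <= S by apply: sumr_ge0.
have P0 : 0 <= normal_peak s ^+ n by rewrite exprn_ge0 ?normal_peak_ge0.
have KV' x : expR (- V x) <= K * expR (- (c * \sum_i `|x ord0 i|)).
  by rewrite -prod_expR_normr.
have q0 x y : 0 <= mala_density V s x y by exact/ltW/mala_density_gt0.
(* If [S] is large then [e^{-V z}] is small; otherwise [z] is at distance at
   least [L] from the mean of the proposal made at [b]. *)
have [LS|SL] := leP L S.
  rewrite ge_min; apply/orP; right.
  rewrite mulrCA [leLHS]mulrC ler_pM ?expR_ge0 ?mala_density_le//.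
  rewrite (le_trans (KV' z))// ler_wpM2l// ler_expR -/S.
  have : c * L <= c * S by rewrite ler_pM2l.
  by lra.
rewrite ge_min; apply/orP; left.
have zS : `|z ord0 i| <= S.
  by rewrite /S (bigD1 i)//= lerDl sumr_ge0.
have Lz : L <= `|z ord0 i - mala_mean V s b ord0 i|.
  have := lerB_dist (mala_mean V s b ord0 i) (z ord0 i).
  by rewrite [X in _ <= X -> _]distrC; lra.
apply: ler_pM; [exact: expR_ge0|exact: q0| |].
  rewrite (le_trans (KV' b))// ler_piMr// -expR0 ler_expR oppr_le0.
  by rewrite mulr_ge0 ?(ltW c0)// sumr_ge0.
apply: (le_trans (@mala_density_tail n V s L b z i s01 L0 Lz)).
rewrite ler_wpM2l// ler_expR.
(* By [2 * c <= L] the Gaussian tail is at most [expR (- (c * L))], and [S < L] lets half of this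
   rate be spent on [S]. *)
have cS : c * S <= c * L by rewrite ler_pM2l// ltW.
have : 2 * c * L <= L ^+ 2 by rewrite expr2 ler_wpM2r.
lra.
Qed.

(** One term of the exponential series gives [e^u >= u^(N+1) / (N+1)!]. [N] is chosen with
    [sg (N+1) >= m], and for a base below 1 the larger exponent gives the smaller power. *)
Lemma expR_powR_le (k sg m : R) : 0 < k -> 0 < sg ->
  exists2 C, 0 < C & forall e, 0 < e -> e < 1 ->
    expR (- (k * e `^ (- sg))) <= C * e `^ m.
Proof.
move=> k0 sg0; set N := Num.truncn (m / sg).
have mN : m <= sg * N.+1%:R.
  rewrite mulrC -ler_pdivrMr//.
  by rewrite ltW// truncnS_gt.
exists ((N.+1)`!%:R / k ^+ N.+1); first by rewrite divr_gt0 ?exprn_gt0// ltr0n fact_gt0.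
move=> e e0 e1; set u := k * _.
have u0 : 0 < u by rewrite mulr_gt0// powR_gt0.
have f0 : 0 < (N.+1)`!%:R :> R by rewrite ltr0n fact_gt0.
apply: (@le_trans _ _ ((N.+1)`!%:R / u ^+ N.+1)).
  rewrite expRN -[leRHS]invrK lef_pV2 ?posrE ?expR_gt0 ?invr_gt0 ?divr_gt0 ?exprn_gt0//.
  rewrite invf_div (le_trans _ (expR_ge1Dxn N (ltW u0)))// lerDr ler01//.
rewrite /u exprMn invfM mulrA ler_wpM2l//.
  by rewrite divr_ge0 ?exprn_ge0// ltW.
rewrite -powR_mulrn ?powR_ge0// -powRrM mulNr powRN invrK.
by apply: ger_powR; [rewrite e0 ltW|].
Qed.

End estimates.

(** * The oscillating part of the potential *)

Section potential.
Set Implicit Arguments.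
Unset Strict Implicit.
Context {R : realType} {n : nat}.
Variables (A l : 'I_n -> R) (eps : R).

(** Along axis [i] only the summand [i] varies, so the difference quotient coincides with that of a
    function of one variable. *)
Lemma is_derive_cos_potential (i : 'I_n) (x : 'rV[R]_n) :
  is_derive x (delta_mx ord0 i) (cos_potential A l eps)
    (- (A i / (l i * eps) * sin (x ord0 i / (l i * eps)))).
Proof.
set w := l i * eps.
pose g t := A i * cos (t / w).
have dg : is_derive (x ord0 i) (1 : R) g (- (A i / w * sin (x ord0 i / w))).
  have d1 : is_derive (x ord0 i) (1 : R) (fun t : R => t / w) w^-1.
    have -> : (fun t : R => t / w) = w^-1 \*: (id : R -> R).
      by apply/funext => t; rewrite mulrC.
    apply: (is_derive_eq (@is_deriveZ R R R id w^-1 _ 1 1 (is_derive_id _ _))).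
    by rewrite /GRing.scale/= mulr1.
  have d2 := @is_derive1_comp R cos (fun t => t / w) (x ord0 i) _ _
    (is_derive_cos _) d1.
  apply: (is_derive_eq (@is_deriveZ R R R _ (A i) (x ord0 i) 1 _ d2)).
  by rewrite /GRing.scale/=; ring.
have quotE : (fun h : R => h^-1 *: ((cos_potential A l eps \o shift x)
      (h *: delta_mx ord0 i) - cos_potential A l eps x)) =
    (fun h : R => h^-1 *: ((g \o shift (x ord0 i)) (h *: (1 : R)) - g (x ord0 i))).
  apply/funext => h; congr (_ *: _); rewrite /= /cos_potential.
  rewrite (bigD1 i)//= [X in _ - X](bigD1 i)//= opprD addrACA.
  rewrite [X in _ + X](_ : _ = 0) ?addr0.
    by rewrite !mxE !eqxx /g /GRing.scale/= mulr1.
  apply/eqP; rewrite subr_eq0; apply/eqP; apply: eq_bigr => j ji.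
  by rewrite !mxE (negbTE ji) andbF mulr0 add0r.
apply: DeriveDef.
  by rewrite /derivable quotE; exact: (@ex_derive _ _ _ _ _ _ _ dg).
by rewrite /derive quotE; exact: (@derive_val _ _ _ _ _ _ _ dg).
Qed.

Lemma partialD_cos_potential (V0 : 'rV[R]_n -> R) (i : 'I_n) (x : 'rV[R]_n) :
  derivable V0 x (delta_mx ord0 i) ->
  partial i (V0 \+ cos_potential A l eps) x =
  partial i V0 x - A i / (l i * eps) * sin (x ord0 i / (l i * eps)).
Proof.
move=> dV0; have dc := is_derive_cos_potential i x.
by rewrite /partial deriveD// (@derive_val _ _ _ _ _ _ _ dc).
Qed.

(** The bound is free of [eps] and [l], which makes the constants derived from the potential uniform
    in [eps]. *)
Lemma cos_potential_bound (Ahi : R) (x : 'rV[R]_n) :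
  (forall i, `|A i| <= Ahi) -> `|cos_potential A l eps x| <= n%:R * Ahi.
Proof.
move=> AA; rewrite (le_trans (ler_norm_sum _ _ _))//.
rewrite (@le_trans _ _ (\sum_(i < n) Ahi))//; last first.
  by rewrite sumr_const card_ord mulr_natl.
apply: ler_sum => i _; rewrite normrM -[leRHS]mulr1 ler_pM//.
by rewrite ler_norml cos_geN1 cos_le1.
Qed.

Lemma measurable_cos_potential :
  measurable_fun [set: 'rV[R]_n] (cos_potential A l eps).
Proof.
apply: measurable_sum => i; apply: measurable_funM => //.
have mc : measurable_fun [set: R] (cos : R -> R).
  by apply: continuous_measurable_fun; exact: continuous_cos.
apply: (measurableT_comp mc); apply: measurable_funM => //.
exact: measurable_coord.
Qed.

End potential.

(** * Gap bounds under an exponential envelope for the Gibbs weight *)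

Section gap_gibbs_mala.
Set Implicit Arguments.
Unset Strict Implicit.
Context {R : realType} {n : nat}.

(** A general interval as side allows a closed test cube [[a, b]] with [0 <= a] next to the
    half-open cube [[- r, 0[], disjoint from it when [n > 0]. *)
Definition cube (i : interval R) : set 'rV[R]_n :=
  [set x | forall j, [set` i] (x ord0 j)].

Lemma measurable_cube i : measurable (cube i).
Proof. by apply: (@measurable_box R n (fun=> [set` i])) => j. Qed.

Lemma lebesgue_rV_cube (a b : R) (ba bb : bool) : a < b ->
  lebesgue_rV n (cube (Interval (BSide ba a) (BSide bb b))) =
  ((b - a) ^+ n)%:E.
Proof.
move=> ab; apply: (etrans (@lebesgue_rV_box R n
  (fun=> [set` Interval (BSide ba a) (BSide bb b)]) _)) => //.
under eq_bigr do rewrite lebesgue_measure_itv/= lte_fin ab -EFinB.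
by rewrite prodEFin prodr_const card_ord.
Qed.

Definition expR_norm_mass (c : R) : R :=
  fine (\int[lebesgue_measure]_t (expR (- (c * `|t|)))%:E)%E.

Lemma measurable_prod_expR_normr (c : R) :
  measurable_fun [set: 'rV[R]_n]
    (fun x : 'rV[R]_n => \prod_i expR (- (c * `|x ord0 i|))).
Proof.
apply: (@measurable_prod_rV R n (fun _ t => expR (- (c * `|t|)))) => _.
apply: measurableT_comp => //; apply: measurableT_comp => //.
by apply: measurable_funM => //; exact: measurableT_comp.
Qed.

Lemma integral_prod_expR_normr (K c : R) : 0 < c -> 0 <= K ->
  (\int[lebesgue_rV n]_x (K * \prod_i expR (- (c * `|x ord0 i|)))%:E =
   (K * expR_norm_mass c ^+ n)%:E)%E.
Proof.
move=> c0 K0; under eq_integral do rewrite EFinM.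
have mp : measurable_fun [set: 'rV[R]_n]
    (fun x : 'rV[R]_n => (\prod_i expR (- (c * `|x ord0 i|)))%:E).
  by apply/measurable_EFinP; exact: measurable_prod_expR_normr.
have p0 (x : 'rV[R]_n) : (0 <= (\prod_i expR (- (c * `|x ord0 i|)))%:E)%E.
  by rewrite lee_fin prodr_ge0// => i _; exact: expR_ge0.
rewrite ge0_integralZl ?lee_fin//.
rewrite (@integral_prod_rV R n (fun _ t => expR (- (c * `|t|)))); last 2 first.
- move=> _; apply: measurableT_comp => //; apply: measurableT_comp => //.
  by apply: measurable_funM => //; exact: measurableT_comp.
- by move=> _ t; exact: expR_ge0.
under eq_bigr do rewrite -(fineK (integral_expR_normr c0)).
by rewrite prodEFin prodr_const card_ord EFinM.
Qed.

Variables (V : 'rV[R]_n -> R) (K c M r : R) (F : R -> R).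
Hypotheses (n_gt0 : (0 < n)%N) (mV : measurable_fun setT V).
Hypotheses (c0 : 0 < c) (K0 : 0 <= K) (r0 : 0 < r).
Hypothesis KV : forall x : 'rV[R]_n,
  expR (- V x) <= K * \prod_i expR (- (c * `|x ord0 i|)).
Hypothesis VM : forall x : 'rV[R]_n, (forall i, `|x ord0 i| <= r) -> V x <= M.
Hypothesis F_acc : F = metropolis \/ F = barker.

Let Zmax := K * expR_norm_mass c ^+ n.

Let VM_left x : cube `[- r, 0[ x -> V x <= M.
Proof.
move=> xB; apply: VM => i; have := xB i; rewrite /= in_itv/= => /andP[? ?].
by rewrite ler_norml; apply/andP; split; lra.
Qed.

Let VM_right (a b : R) x : 0 <= a -> b <= r -> cube `[a, b] x -> V x <= M.
Proof.
move=> a0 br xB; apply: VM => i; have := xB i; rewrite /= in_itv/= => /andP[? ?].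
by rewrite ler_norml; apply/andP; split; lra.
Qed.

Let mweight : measurable_fun setT (fun x => (expR (- V x))%:E).
Proof.
apply/measurable_EFinP; apply: measurableT_comp => //.
exact: measurableT_comp.
Qed.

(** Finite by the exponential envelope, positive because [V <= M] on a cube of side [r]. *)
Lemma partition_function : exists Z : R,
  [/\ 0 < Z, Z <= Zmax & (\int[lebesgue_rV n]_x (expR (- V x))%:E = Z%:E)%E].
Proof.
have ub : (\int[lebesgue_rV n]_x (expR (- V x))%:E <= Zmax%:E)%E.
  rewrite -integral_prod_expR_normr//; apply: ge0_le_integralT => x.
    by rewrite lee_fin expR_ge0.
  by rewrite lee_fin.
have lb : ((expR (- M) * r ^+ n)%:E <= \int[lebesgue_rV n]_x (expR (- V x))%:E)%E.
  have mB := measurable_cube `[- r, 0[.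
  have r0' : - r < 0 by rewrite oppr_lt0.
  have := lebesgue_rV_cube true true r0'; rewrite sub0r opprK => vB.
  have w0 (x : 'rV[R]_n) : (0 <= (expR (- V x))%:E)%E by rewrite lee_fin expR_ge0.
  apply: (le_trans _ (@ge0_subset_integral _ _ _ (lebesgue_rV n) _ _ mB
    measurableT _ mweight (fun x _ => w0 x) (@subsetT _ _))).
  rewrite EFinM -vB -integral_cst//; apply: ge0_le_integral => //.
  + by move=> x _; rewrite lee_fin expR_ge0.
  + exact: measurable_funTS.
  + by move=> x xB; rewrite lee_fin ler_expR lerN2 VM_left.
have If : (\int[lebesgue_rV n]_x (expR (- V x))%:E)%E \is a fin_num.
  rewrite ge0_fin_numE; first exact: le_lt_trans ub (ltry _).
  by apply: integral_ge0 => x _; rewrite lee_fin expR_ge0.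
exists (fine (\int[lebesgue_rV n]_x (expR (- V x))%:E)%E); split.
- rewrite -lte_fin fineK//; apply: lt_le_trans lb.
  by rewrite lte_fin mulr_gt0 ?expR_gt0 ?exprn_gt0.
- by rewrite -lee_fin fineK.
- by rewrite fineK.
Qed.

(** The complement of the test cube contains the cube [[- r, 0[], whose mass has a lower bound
    independent of [a] and [b]. *)
Lemma gap_le_cube (s a b D Z : R) : 0 < s -> 0 <= a -> a < b -> b <= r ->
  0 < Z -> (\int[lebesgue_rV n]_x (expR (- V x))%:E = Z%:E)%E ->
  (\int[gibbs V]_x mala F V s
     (fun y => (`|\1_(cube `[a, b]) y - \1_(cube `[a, b]) x| ^+ 2)%:E) x
   <= D%:E)%E ->
  (gap (gibbs V) (mala F V s) <=
   (D / (2 * ((b - a) ^+ n * expR (- M) / Z * (r ^+ n * expR (- M) / Z))))%:E)%E.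
Proof.
move=> s0 a0 ab br Z0 ZE ID; set B := cube `[a, b].
have mB : measurable B by exact: measurable_cube.
apply: (gap_le_indic mB).
- by rewrite !mulr_gt0 ?invr_gt0 ?expR_gt0// exprn_gt0// subr_gt0.
- by rewrite !mulr_gt0 ?invr_gt0 ?expR_gt0// exprn_gt0.
- apply: gibbs_ge => //; first exact: lebesgue_rV_cube.
  by move=> x; exact: VM_right.
- apply: (@le_trans _ _ (gibbs V (cube `[- r, 0[))).
    apply: gibbs_ge => //; first exact: measurable_cube.
      by rewrite lebesgue_rV_cube ?oppr_lt0// sub0r opprK.
  apply: le_measure; rewrite ?inE.
  - exact: measurable_cube.
  - exact: measurableC.
  (* [n > 0] supplies a coordinate, which would be both negative and at least [a]. *)
  - move=> x xl xB; have := xl (Ordinal n_gt0); have := xB (Ordinal n_gt0).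
    by rewrite /= !in_itv/= => /andP[? _] /andP[_ ?]; lra.
- apply/andP; split; last exact: ID.
  by apply: integral_ge0 => x _; apply: mala_indic_ge0.
Qed.

(** The flow out of any set is at most 1 and the cube [[0, r]] is fixed, so the bound does not
    involve [s]. *)
Lemma gap_gibbs_mala_bounded s : 0 < s ->
  (gap (gibbs V) (mala F V s) <=
   (Zmax ^+ 2 / (2 * (r ^+ n * expR (- M)) ^+ 2))%:E)%E.
Proof.
move=> s0; have [Z [Z0 ZZ ZE]] := partition_function.
have := @gap_le_cube s 0 r 1 Z s0 (lexx 0) r0 (lexx r) Z0 ZE
  (dirichlet_indic_le1 V s0 F_acc _).
move=> /le_trans; apply.
rewrite subr0 lee_fin.
have u0 : 0 < r ^+ n * expR (- M) by rewrite mulr_gt0 ?expR_gt0// exprn_gt0.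
move: (r ^+ n * expR (- M)) u0 => u u0.
have -> : 1 / (2 * (u / Z * (u / Z))) = Z ^+ 2 / (2 * u ^+ 2).
  by field; rewrite !gt_eqF.
rewrite ler_pM2r ?invr_gt0 ?mulr_gt0 ?exprn_gt0//.
by rewrite lerXn2r// nnegrE ltW// (lt_le_trans Z0).
Qed.

(** The volume of the test cube appears both in the flow bound and in the mass of the cube and
    cancels, so a cube of side of order [eps] costs no power of [eps]. *)
Lemma gap_gibbs_mala_drift (s L a b : R) (i : 'I_n) :
  0 < s <= 1 -> 0 <= a -> a < b -> b <= r -> 2 * c <= L ->
  (forall x : 'rV[R]_n, cube `[a, b] x -> 2 * L <= `|mala_mean V s x ord0 i|) ->
  (gap (gibbs V) (mala F V s) <=
   (K * normal_peak s ^+ n * expR (- (c / 2 * L)) * expR_norm_mass (c / 2) ^+ n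
    * Zmax / (r ^+ n * expR (- M) ^+ 2))%:E)%E.
Proof.
move=> s01 a0 ab br cL drift; have /andP[s0 s1] := s01.
have [Z [Z0 ZZ ZE]] := partition_function.
have c20 : 0 < c / 2 by rewrite divr_gt0.
set K' := K * normal_peak s ^+ n * expR (- (c / 2 * L)).
have K'0 : 0 <= K'.
  by rewrite !mulr_ge0 ?expR_ge0// exprn_ge0// normal_peak_ge0.
have hI := integral_prod_expR_normr c20 K'0.
have vB := lebesgue_rV_cube true false ab.
have := @dirichlet_indic_le R n V Z s F mV Z0 s0 ZE F_acc (cube `[a, b]) _ _ _
  (measurable_cube _) vB _ _ hI _.
have H1 : measurable_fun setT
    (fun x : 'rV[R]_n => K' * \prod_i expR (- (c / 2 * `|x ord0 i|))).
  by apply: measurable_funM => //; exact: measurable_prod_expR_normr.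
have H2 (x : 'rV[R]_n) : 0 <= K' * \prod_i expR (- (c / 2 * `|x ord0 i|)).
  by rewrite mulr_ge0// prodr_ge0// => j _; exact: expR_ge0.
move=> /(_ H1 H2) /(_ (fun x z xB => mala_flow_tail z s01 c0 K0 KV cL (drift x xB))) ID.
apply: (le_trans (gap_le_cube s0 a0 ab br Z0 ZE ID)).
set I := K' * _; rewrite lee_fin.
have I0 : 0 <= I.
  by rewrite mulr_ge0// exprn_ge0// fine_ge0// integral_ge0// => t _; rewrite lee_fin expR_ge0.
have v0 : 0 < (b - a) ^+ n by rewrite exprn_gt0// subr_gt0.
have u0 : 0 < r ^+ n by rewrite exprn_gt0.
have e0 : 0 < expR (- M) by exact: expR_gt0.
move: ((b - a) ^+ n) (r ^+ n) (expR (- M)) v0 u0 e0 => v u e v0 u0 e0.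
have -> : 2 * v * I / Z / (2 * (v * e / Z * (u * e / Z))) = I * Z / (u * e ^+ 2).
  by field; rewrite !gt_eqF.
rewrite ler_pM2r ?invr_gt0 ?mulr_gt0 ?exprn_gt0//.
by rewrite ler_wpM2l.
Qed.

End gap_gibbs_mala.

(** * Size of the drift, and local and global bounds on the potential *)

Section drift.
Set Implicit Arguments.
Unset Strict Implicit.
Context {R : realType} {n : nat}.

Lemma coord_le_enorm (x : 'rV[R]_n) i : `|x ord0 i| <= enorm x.
Proof.
rewrite -sqrtr_sqr /enorm ler_sqrt ?sumr_ge0// => [|j _]; last exact: sqr_ge0.
by rewrite (bigD1 i)//= lerDl sumr_ge0// => j _; exact: sqr_ge0.
Qed.

Lemma enorm_le_sqrt (x : 'rV[R]_n) :
  (forall i, `|x ord0 i| <= 1) -> enorm x <= Num.sqrt n%:R.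
Proof.
move=> x1; rewrite /enorm ler_sqrt ?ler0n//.
rewrite (@le_trans _ _ (\sum_(i < n) 1))//; last first.
  by rewrite sumr_const card_ord.
apply: ler_sum => i _; rewrite -real_normK ?num_real//.
by rewrite expr_le1.
Qed.

(** The oscillating part moves the mean by at least [4 * L], while the gradient of [V0] and the
    position together contribute at most [G / 2 + 1 <= L]. *)
Lemma mala_drift_ge (V0 : 'rV[R]_n -> R) (A l : 'I_n -> R)
    (Alo lhi eps alpha G : R) (i : 'I_n) (x : 'rV[R]_n) :
  derivable V0 x (delta_mx ord0 i) -> `|partial i V0 x| <= G ->
  0 < Alo -> Alo <= `|A i| -> 0 < l i -> l i <= lhi ->
  0 < eps < 1 -> 0 <= alpha -> `|x ord0 i| <= 1 ->
  2^-1 <= sin (x ord0 i / (l i * eps)) ->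
  let L := Alo / (16 * lhi) * eps `^ (2 * alpha - 1) in
  G + 1 <= L ->
  2 * L <= `|mala_mean (V0 \+ cos_potential A l eps) (eps `^ alpha) x ord0 i|.
Proof.
move=> dV0 Gx Alo0 Ai l0 lh /andP[e0 e1] al0 x1 sx L GL.
have lhi0 : 0 < lhi by exact: lt_le_trans lh.
rewrite /mala_mean !mxE partialD_cos_potential//.
set w := l i * eps; set S := sin _ in sx *; set g := partial _ _ _ in Gx *.
set s2 := (eps `^ alpha) ^+ 2.
have s20 : 0 < s2 by rewrite exprn_gt0// powR_gt0.
have s21 : s2 <= 1.
  by rewrite expr_le1 ?powR_ge0// -(powRr0 eps) ger_powR// e0 ltW.
have LE : L = s2 * (Alo / (16 * lhi * eps)).
  rewrite /L /s2 -powR_mulrn ?powR_ge0// -powRrM.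
  rewrite powRB; last by rewrite (gt_eqF e0) implybT.
  rewrite powRr1 ?(ltW e0)// [alpha * _]mulrC.
  by field; rewrite !gt_eqF.
clearbody s2 S g.
have T4 : 4 * L <= `|s2 / 2 * (A i / w * S)|.
  rewrite LE !normrM (gtr0_norm s20) !normfV (normr_nat R 2).
  rewrite (@ger0_norm _ S) ?(le_trans _ sx)//.
  rewrite (@gtr0_norm _ w) ?mulr_gt0//.
  (* This fixes the constant 16 in [L]: the margin 4, the factor 1/2 of the drift and the lower
     bound 1/2 of the sine. *)
  have -> : 4 * (s2 * (Alo / (16 * lhi * eps))) =
      s2 / 2 * (Alo / (lhi * eps) * 2^-1) by field; rewrite !gt_eqF.
  rewrite ler_pM2l ?divr_gt0//; apply: ler_pM => //.
  - by rewrite divr_ge0// ?mulr_ge0// ltW.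
  - apply: ler_pM => //.
    + exact: ltW.
    + by rewrite invr_ge0 mulr_ge0 ?ltW.
    by rewrite lef_pV2 ?posrE ?mulr_gt0// ler_pM2r.
have g2 : `|s2 / 2 * g| <= G / 2.
  rewrite normrM gtr0_norm ?divr_gt0// mulrAC ler_pM2r//.
  rewrite (le_trans _ Gx)// ler_piMl//.
have -> : x ord0 i - s2 / 2 * (g - A i / w * S) =
   s2 / 2 * (A i / w * S) - (s2 / 2 * g - x ord0 i) by ring.
have := lerB_dist (s2 / 2 * (A i / w * S)) (s2 / 2 * g - x ord0 i).
have := ler_normB (s2 / 2 * g) (x ord0 i).
have G0 : 0 <= G := le_trans (normr_ge0 _) Gx.
lra.
Qed.

(** [rho <= 1] keeps [pi / 2 - rho] nonnegative, hence also the lower end of the test cube. *)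
Lemma sin_near_pihalf : exists2 rho : R, 0 < rho <= 1 &
  forall t, `|t - pi / 2| <= rho -> 2^-1 <= sin t.
Proof.
have /cvgrPdist_lt /(_ 2^-1) := @continuous_sin R (pi / 2).
have h0 : 0 < 2^-1 :> R by rewrite invr_gt0.
move=> /(_ h0) /nbhs_ballP[e /= e0 He].
exists (Num.min (e / 2) 1).
  by rewrite lt_min divr_gt0//= ltr01 ge_min lexx orbT.
move=> t; rewrite le_min => /andP[te _].
have := He t; rewrite -ball_normE/= sin_pihalf distrC => /(_ _) H.
have : `|1 - sin t| < 2^-1 by apply: H; lra.
rewrite ltr_distl; lra.
Qed.

(** Balls of the sup norm are cubes; [r <= 1] lets the gradient bound on the unit cube apply there
    too. *)
Lemma continuous_le_cube (V0 : 'rV[R]_n -> R) : continuous V0 ->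
  exists2 r : R, 0 < r <= 1 &
  forall x : 'rV[R]_n, (forall i, `|x ord0 i| <= r) -> V0 x <= V0 0 + 1.
Proof.
move=> cV0; have /cvgrPdist_lt /(_ 1 ltr01) /nbhs_ballP[e /= e0 He] := cV0 0.
exists (Num.min (e / 2) 1).
  by rewrite lt_min divr_gt0//= ltr01 ge_min lexx orbT.
move=> x xr; have : `|V0 0 - V0 x| < 1.
  apply: He; split => // i j; have -> : i = ord0 by exact: ord1.
  rewrite -ball_normE/= mxE sub0r normrN.
  by have := xr j; rewrite le_min => /andP[? _]; lra.
rewrite ltr_distl; lra.
Qed.

(** The loss [Cp * n%:R] comes from passing to linear growth in each coordinate, the loss
    [n%:R * Ahi] from the oscillating part. *)
Lemma expRN_potential_le (V0 : 'rV[R]_n -> R) (A l : 'I_n -> R)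
    (p Vmin Cp Ahi eps : R) (x : 'rV[R]_n) :
  1 <= p -> 0 < Cp -> (forall i, `|A i| <= Ahi) ->
  Vmin + Cp * \sum_(i < n) `|x ord0 i| `^ p <= V0 x ->
  expR (- (V0 \+ cos_potential A l eps) x) <=
  expR (- (Vmin - Cp * n%:R - n%:R * Ahi)) *
    \prod_i expR (- (Cp * `|x ord0 i|)).
Proof.
move=> p1 Cp0 AA Vx; rewrite prod_expR_normr -expRD ler_expR.
have := cos_potential_bound l eps x AA; rewrite ler_norml => /andP[cb _].
have : Cp * (\sum_(i < n) `|x ord0 i| - n%:R) <= Cp * \sum_(i < n) `|x ord0 i| `^ p.
  rewrite ler_pM2l// -[n%:R](_ : \sum_(i < n) 1 = _); last first.
    by rewrite sumr_const card_ord.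
  by rewrite -sumrB ler_sum// => i _; exact: normr_le1D_powR.
rewrite /=; lra.
Qed.

End drift.

(** * Choice of the cube and the constants as [eps] tends to 0 *)

Theorem theorem2p13 (R : realType) (n : nat) (n_ge1 : (1 <= n)%N)
    (F : R -> R) (F_acc : F = metropolis \/ F = barker)
    (V0 : 'rV[R]_n -> R) (V0_smooth : smooth V0) (V0_trapping : trapping V0)
    (p Vmin Cp : R) (p_ge1 : 1 <= p) (Cp_gt0 : 0 < Cp)
    (V0_lower : forall x : 'rV[R]_n,
      Vmin + Cp * \sum_(i < n) `|x ord0 i| `^ p <= V0 x)
    (delta D0 D1 : R) (delta_gt0 : 0 < delta)
    (V0_grad : forall x : 'rV[R]_n,
      enorm (grad V0 x) <= D0 + D1 * enorm x `^ delta)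
    (A l : 'I_n -> R) (Alo Ahi llo lhi : R)
    (Alo_gt0 : 0 < Alo) (llo_gt0 : 0 < llo)
    (A_bounds : forall i, Alo <= `|A i| <= Ahi)
    (l_bounds : forall i, llo <= l i <= lhi)
    (alpha theta gamma : R) (alpha_ge0 : 0 <= alpha) (gamma_gt0 : 0 < gamma)
    (exponents : 2 * alpha + delta * gamma + theta < 1) :
  exists kappa C : R, [/\ 0 < kappa, 0 < C &
    \forall eps \near 0^'+,
      let V := V0 \+ cos_potential A l eps in
      (gap (gibbs V) (mala F V (eps `^ alpha)) <=
       (C * (expR (- (1 / 2) * kappa * eps `^ (- gamma * p))
             + expR (- (1 / 32) * eps `^ (- 2 * (1 - alpha - theta)))
             + eps `^ (n%:R * (2 * theta - alpha))))%:E)%E].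
Proof.
have dg0 : 0 < delta * gamma by rewrite mulr_gt0.
pose i0 := Ordinal n_ge1.
have /andP[A1 A2] := A_bounds i0; have /andP[l1 l2] := l_bounds i0.
have li0 : 0 < l i0 by exact: lt_le_trans l1.
have lhi0 : 0 < lhi by exact: lt_le_trans l2.
have AA i : `|A i| <= Ahi by have /andP[] := A_bounds i.
have cV0 : continuous V0 by have [] := V0_smooth 0%N.
have dV0 i x : derivable V0 x (delta_mx ord0 i).
  by have [_ /(_ i)[]] := V0_smooth 1%N.
have [r /andP[r0 r1] V0r] := continuous_le_cube cV0.
(* [K], [M] and [r] are fixed before [eps]; the envelope and the upper bound near the origin hold
   with them for every [eps]. *)
pose K := expR (- (Vmin - Cp * n%:R - n%:R * Ahi)).
have K0 : 0 <= K by exact: expR_ge0.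
pose M := V0 0 + 1 + n%:R * Ahi.
have mV eps : measurable_fun [set: 'rV[R]_n] (V0 \+ cos_potential A l eps).
  apply: measurable_funD; first exact: continuous_measurable_rV.
  exact: measurable_cos_potential.
have KV eps (x : 'rV[R]_n) : expR (- (V0 \+ cos_potential A l eps) x) <=
    K * \prod_i expR (- (Cp * `|x ord0 i|)) by exact: expRN_potential_le (V0_lower x).
have VM eps (x : 'rV[R]_n) : (forall i, `|x ord0 i| <= r) ->
    (V0 \+ cos_potential A l eps) x <= M.
  move=> xr; rewrite /= lerD ?V0r//.
  by have := cos_potential_bound l eps x AA; rewrite ler_norml => /andP[].
have J0 c : 0 <= expR_norm_mass c :> R.
  by rewrite fine_ge0// integral_ge0// => t _; rewrite lee_fin expR_ge0.
(* Only the last summand of the bound is used, so any [kappa] will do. *)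
have tail (C X : R) eps : 0 <= C -> 0 <= X ->
    C * X <= (C + 1) * (expR (- (1 / 2) * 1 * eps `^ (- gamma * p))
             + expR (- (1 / 32) * eps `^ (- 2 * (1 - alpha - theta))) + X).
  move=> C0 X0; apply: ler_pM => //; first by rewrite lerDl.
  by rewrite lerDr addr_ge0 ?expR_ge0.
have [a2|a2] := leP 2^-1 alpha.
  have ex0 : n%:R * (2 * theta - alpha) <= 0.
    by rewrite mulr_ge0_le0 ?ler0n//; lra.
  set C := (K * expR_norm_mass Cp ^+ n) ^+ 2 / (2 * (r ^+ n * expR (- M)) ^+ 2).
  have C0 : 0 <= C.
    by rewrite divr_ge0 ?sqr_ge0// mulr_ge0 ?sqr_ge0.
  exists 1, (C + 1); split => //; first by rewrite ltr_wpDl.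
  near=> eps; set V := (V0 \+ _); rewrite /=.
  have e0 : 0 < eps by near: eps; exact: nbhs_right_gt.
  have e1 : eps < 1 by near: eps; exact: nbhs_right_lt.
  have := gap_gibbs_mala_bounded n_ge1 (mV eps) Cp_gt0 K0 r0 (KV eps) (VM eps)
    F_acc (powR_gt0 alpha e0).
  move=> /le_trans; apply; rewrite lee_fin -/C.
  have X1 : 1 <= eps `^ (n%:R * (2 * theta - alpha)).
    by rewrite -[leLHS](powRr0 eps) ger_powR// e0 ltW.
  apply: le_trans (tail C _ eps C0 (le_trans ler01 X1)).
  by rewrite ler_peMr.
have [rho /andP[rho0 rho1] sin_ge] := @sin_near_pihalf R.
(* The gradient bound on the unit sup-norm ball, where the Euclidean norm is at most [sqrt n]; the
   signs of [D0] and [D1] are arbitrary. *)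
pose G := `|D0| + `|D1| * Num.sqrt n%:R `^ delta.
have partialG (x : 'rV[R]_n) i : (forall j, `|x ord0 j| <= 1) ->
    `|partial i V0 x| <= G.
  move=> x1; have := coord_le_enorm (grad V0 x) i; rewrite mxE.
  move=> /le_trans; apply; rewrite (le_trans (V0_grad x))// lerD ?ler_norm//.
  rewrite (le_trans (ler_norm _))// normrM ler_wpM2l//.
  rewrite ger0_norm ?powR_ge0// ge0_ler_powR ?nnegrE ?sqrtr_ge0 ?(ltW delta_gt0)//.
  exact: enorm_le_sqrt.
have G0 : 0 <= G by rewrite addr_ge0// mulr_ge0 ?powR_ge0.
pose sg := 1 - 2 * alpha; have sg0 : 0 < sg by rewrite /sg; lra.
pose k0 := Alo / (16 * lhi).
have k00 : 0 < k0 by rewrite divr_gt0// mulr_gt0.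
have k10 : 0 < Cp / 2 * k0 by rewrite mulr_gt0// divr_gt0.
(* The peak of the proposal contributes [eps^(- n alpha)], so the exponential has to supply
   [eps^(2 n theta)]. *)
have [C1 C10 HC1] := expR_powR_le (n%:R * (2 * theta)) k10 sg0.
pose C2 := K * expR_norm_mass (Cp / 2) ^+ n * (K * expR_norm_mass Cp ^+ n) /
  (r ^+ n * expR (- M) ^+ 2).
have C20 : 0 <= C2.
  by rewrite divr_ge0 ?mulr_ge0 ?exprn_ge0 ?expR_ge0 ?(ltW r0).
have C120 : 0 <= C2 * C1 by rewrite mulr_ge0// ltW.
exists 1, (C2 * C1 + 1); split => //; first by rewrite ltr_wpDl.
(* [eps <= e2] amounts to [eps^(- sg) >= X], that is [L >= 2 * Cp + G + 1]; this covers [G + 1 <= L]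
   for the drift and [2 * Cp <= L] for the flow. *)
pose X := (2 * Cp + G + 1) / k0.
have X0 : 0 < X by rewrite divr_gt0// ltr_wpDl// addr_ge0// mulr_ge0// ltW.
pose e2 := X^-1 `^ sg^-1.
have e20 : 0 < e2 by rewrite powR_gt0// invr_gt0.
have pi1 := pi_ge2 R.
(* Below [e3] the test cube fits into the cube of half-side [r]. *)
pose e3 := r / (lhi * (pi / 2 + rho)).
have e30 : 0 < e3 by rewrite divr_gt0// mulr_gt0//; lra.
near=> eps; set V := (V0 \+ _); rewrite /=.
have e0 : 0 < eps by near: eps; exact: nbhs_right_gt.
have e1 : eps < 1 by near: eps; exact: nbhs_right_lt.
have ee2 : eps <= e2 by near: eps; exact: nbhs_right_le.
have ee3 : eps <= e3 by near: eps; exact: nbhs_right_le.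
pose L := k0 * eps `^ (2 * alpha - 1).
have Lbig : 2 * Cp + G + 1 <= L.
  rewrite /L [leRHS]mulrC -ler_pdivrMr// -/X.
  rewrite (_ : 2 * alpha - 1 = - sg); last by rewrite /sg opprB.
  rewrite powRN -[leLHS]invrK lef_pV2 ?posrE ?invr_gt0 ?powR_gt0//.
  rewrite (_ : X^-1 = e2 `^ sg); last first.
    by rewrite /e2 -powRrM mulVf ?gt_eqF// powRr1// invr_ge0 ltW.
  by rewrite ge0_ler_powR ?nnegrE ?ltW.
have w0 : 0 < l i0 * eps by rewrite mulr_gt0.
(* These ends place [x_i0 / (l_i0 eps)] within [rho] of [pi / 2]. All coordinates share this
   interval, but the drift is exploited in coordinate [i0] alone. *)
pose a := l i0 * eps * (pi / 2 - rho); pose b := l i0 * eps * (pi / 2 + rho).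
have a0 : 0 <= a by rewrite mulr_ge0 ?(ltW w0)//; lra.
have ab : a < b by rewrite ltr_pM2l//; lra.
have br : b <= r.
  have le3 : lhi * (pi / 2 + rho) * eps <= r.
    by rewrite mulrC -ler_pdivlMr ?mulr_gt0//; lra.
  apply: le_trans le3; rewrite /b mulrAC ler_pM2r// ler_pM2r//; lra.
have s01 : 0 < eps `^ alpha <= 1.
  by rewrite powR_gt0//= -(powRr0 eps) ger_powR// e0 ltW.
have drift (x : 'rV[R]_n) : cube `[a, b] x ->
    2 * L <= `|mala_mean V (eps `^ alpha) x ord0 i0|.
  move=> xab; have x1 j : `|x ord0 j| <= 1.
    have := xab j; rewrite /= in_itv/= => /andP[? ?].
    by rewrite ger0_norm; lra.
  apply: (mala_drift_ge (G := G)) => //; first exact: partialG.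
  - by rewrite e0 e1.
  - apply: sin_ge; have := xab i0; rewrite /= in_itv/= => /andP[xa xb].
    rewrite ler_distl -[pi / 2 - rho](mulKf (lt0r_neq0 w0)).
    rewrite -[pi / 2 + rho](mulKf (lt0r_neq0 w0)) -/a -/b ![_^-1 * _]mulrC.
    by rewrite !ler_pM2r ?invr_gt0// xa xb.
  - rewrite -/L; have := Cp_gt0; lra.
have cL : 2 * Cp <= L by lra.
have := gap_gibbs_mala_drift n_ge1 (mV eps) Cp_gt0 K0 r0 (KV eps) (VM eps)
  F_acc s01 a0 ab br cL drift.
move=> /le_trans; apply; rewrite lee_fin.
apply: le_trans (tail (C2 * C1) _ eps C120 (powR_ge0 _ _)).
have Pn : normal_peak (eps `^ alpha) ^+ n <= eps `^ (n%:R * - alpha).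
  rewrite [n%:R * _]mulrC powRrM powR_mulrn ?powR_ge0// powRN.
  rewrite lerXn2r ?nnegrE ?normal_peak_ge0 ?invr_ge0 ?powR_ge0//.
  by apply: normal_peak_le; rewrite powR_gt0.
have En : expR (- (Cp / 2 * L)) <= C1 * eps `^ (n%:R * (2 * theta)).
  by rewrite /L mulrA (_ : 2 * alpha - 1 = - sg) ?HC1// /sg opprB.
have -> : n%:R * (2 * theta - alpha) = n%:R * - alpha + n%:R * (2 * theta).
  by ring.
rewrite powRD; last by rewrite (gt_eqF e0) implybT.
have PE : normal_peak (eps `^ alpha) ^+ n * expR (- (Cp / 2 * L)) <=
    eps `^ (n%:R * - alpha) * (C1 * eps `^ (n%:R * (2 * theta))).
  by apply: ler_pM; rewrite ?exprn_ge0 ?normal_peak_ge0 ?expR_ge0.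
have := ler_wpM2l C20 PE.
rewrite /C2 => H; apply: le_trans (le_trans _ H) _.
  by rewrite le_eqVlt; apply/orP; left; apply/eqP; ring.
by rewrite le_eqVlt; apply/orP; left; apply/eqP; ring.
Unshelve. all: by end_near.
Qed.
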